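(* Let $n\geq 3$ be an integer. (1) For $\ell=n-1$: $e_3(n,\ell,2)=\binom{n}{2}-\frac{n-1}{2}$ if $n$ is odd, and $e_3(n,\ell,2)=\binom{n}{2}-\frac{n-2}{2}$ if $n$ is even. (2) For $\ell=n-2$: $e_3(n,\ell,2)=\binom{n}{2}-\frac{n}{2}$ if $n$ is even, and $e_3(n,\ell,2)=\infty$ if $n$ is odd.
   Context: All graphs are undirected, finite and simple. For a graph $G$ and a nonempty set $S\subseteq V(G)$, the Steiner distance $d_G(S)$ is the minimum number of edges of a connected subgraph (equivalently, a subtree) of $G$ whose vertex set contains $S$; set $d_G(S)=\infty$ if there is none. The Steiner $3$-diameter is $sdiam_3(G)=\max\{d_G(S): S\subseteq V(G),\ |S|=3\}$. For natural numbers $n,\ell,d$ with $d<n$, $\ell<n$, let $\mathscr{H}_3(n,\ell,d)$ be the set of all graphs $G$ of order $n$ with maximum degree exactly $\ell$ and $sdiam_3(G)\leq d$. Put $e_3(n,\ell,d)=\min\{|E(G)|: G\in \mathscr{H}_3(n,\ell,d)\}$, with $e_3(n,\ell,d)=\infty$ if $\mathscr{H}_3(n,\ell,d)=\emptyset$. *)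

(* Defs.v *)
From HB Require Import structures.
From mathcomp Require Import all_boot.

Set Implicit Arguments.
Unset Strict Implicit.
Unset Printing Implicit Defensive.

(* Natural numbers extended with infinity: [None] is the infinite value. *)
Definition enat : Type := option nat.

Definition efin (m : nat) : enat := Some m.
Definition einfty : enat := None.

Definition ele (x y : enat) : bool :=
  match x, y with
  | _, None => true
  | None, Some _ => false
  | Some a, Some b => a <= b
  end.

Definition emax (x y : enat) : enat := if ele x y then y else x.

(* Minimum of f over the elements satisfying P; infinite if there are none. *)
Definition emin_over (T : finType) (P : pred T) (f : T -> nat) : enat :=
  if [pick x | P x] is Some x0 then efin (f [arg min_(x < x0 | P x) f x])
  else einfty.

Record sgraph (V : finType) := SGraph {
  edges : {set {set V}};
  edges_card2 : [forall e in edges, #|e| == 2]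
}.

HB.instance Definition _ (V : finType) := [isSub for @edges V].
HB.instance Definition _ (V : finType) := [Finite of sgraph V by <:].

Section SteinerDistance.
Variables (V : finType) (G : sgraph V).

Definition adjacent (x y : V) : bool := [set x; y] \in edges G.

Definition degree (v : V) : nat := #|[set u | adjacent v u]|.

Definition max_degree : nat := \max_(v : V) degree v.

(* A pair H stands for the candidate subgraph (vertex set, edge set). *)
Definition is_subgraph (H : {set V} * {set {set V}}) : bool :=
  (H.2 \subset edges G) && [forall e in H.2, e \subset H.1].

(* The edges of a subgraph have both ends in its vertex set, so the walks
   considered by [connect] never leave H.1. *)
Definition connected_subgraph (H : {set V} * {set {set V}}) : bool :=
  [&& is_subgraph H, H.1 != set0 &
      [forall x in H.1, forall y in H.1,
         connect [rel u v | [set u; v] \in H.2] x y]].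

Definition steiner_dist (S : {set V}) : enat :=
  emin_over (fun H => connected_subgraph H && (S \subset H.1))
            (fun H => #|H.2|).

(* The value is 0 by convention when there are fewer than three vertices. *)
Definition sdiam3 : enat :=
  \big[emax/efin 0]_(S : {set V} | #|S| == 3) steiner_dist S.

End SteinerDistance.

(* Graphs of order n are represented with vertex set 'I_n; every quantity
   involved is invariant under isomorphism. *)
Definition H3 (n l d : nat) : {set sgraph 'I_n} :=
  [set G | (max_degree G == l) && ele (sdiam3 G) (efin d)].

Definition e3 (n l d : nat) : enat :=
  emin_over (fun G => G \in H3 n l d) (fun G => #|edges G|).

(* Main.v *)
(** A connected subgraph with at most two edges that contains three vertices
    is a path on exactly these vertices, so [sdiam3 G <= 2] says that every
    triple spans at least two edges, i.e. that the complement of [G] is a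
    matching, i.e. that all degrees are at least [n - 2].  The lower bounds on
    the number of edges, and the impossibility for [n] odd, follow from the
    handshake lemma and parity; the extremal graphs are complements of
    matchings with [k] edges, each described by an involution of the vertex set
    moving exactly [2 k] points. *)

Require Import Defs.
From mathcomp Require Import all_boot zify.

Set Implicit Arguments.
Unset Strict Implicit.
Unset Printing Implicit Defensive.

(** * Minima and maxima of extended naturals *)

Lemma emin_over_efin (T : finType) (P : pred T) (f : T -> nat) (x : T) :
  P x -> (forall y, P y -> f x <= f y) -> emin_over P f = efin (f x).
Proof.
move=> Px xmin; rewrite /emin_over; case: pickP => [x0 Px0|/(_ x)]; last by rewrite Px.
case: arg_minnP => // y Py ymin; congr Some.
by apply/eqP; rewrite eqn_leq ymin // xmin.
Qed.

Lemma emin_over_einfty (T : finType) (P : pred T) (f : T -> nat) :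
  (forall x, ~~ P x) -> emin_over P f = einfty.
Proof.
by move=> nP; rewrite /emin_over; case: pickP => // x Px; have := nP x; rewrite Px.
Qed.

Lemma ele_emin_over (T : finType) (P : pred T) (f : T -> nat) (d : nat) :
  reflect (exists2 x, P x & f x <= d) (ele (emin_over P f) (efin d)).
Proof.
rewrite /emin_over; case: pickP => [x0 Px0|noP] /=; last first.
  by apply: (iffP idP) => // -[x]; rewrite noP.
case: arg_minnP => // y Py ymin; apply: (iffP idP) => [|[x Px]]; first by exists y.
by apply: leq_trans; exact: ymin.
Qed.

Lemma ele_emax (x y : enat) (d : nat) :
  ele (emax x y) (efin d) = ele x (efin d) && ele y (efin d).
Proof. by case: x y => [a|] [b|] //=; rewrite /emax /= ?andbF //; case: ifP => /=; lia. Qed.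

Lemma ele_big_emax (I : finType) (P : pred I) (F : I -> enat) (d : nat) :
  reflect (forall i, P i -> ele (F i) (efin d))
          (ele (\big[emax/efin 0]_(i | P i) F i) (efin d)).
Proof.
rewrite (big_morph (fun x => ele x (efin d)) (fun x y => ele_emax x y d)
           (erefl : ele (efin 0) (efin d) = true)) big_andE.
exact: forall_inP.
Qed.

(** * Degrees and Steiner distances of triples *)

Section Graph.
Variables (V : finType) (G : sgraph V).

Lemma card_edge (e : {set V}) : e \in edges G -> #|e| = 2.
Proof. by move=> eG; apply/eqP; have /forall_inP := edges_card2 G; apply. Qed.

Lemma adjacent_sym (x y : V) : adjacent G x y = adjacent G y x.
Proof. by rewrite /adjacent setUC. Qed.

Lemma adjacent_neq (x y : V) : adjacent G x y -> x != y.
Proof. by move/card_edge; rewrite cards2; case: (x != y). Qed.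

Lemma degree_incident (v : V) :
  degree G v = #|[set e in edges G | v \in e]|.
Proof.
rewrite /degree -(card_in_imset (f := fun u => [set v; u])) => [|u w]; last first.
  rewrite !inE => /adjacent_neq vu _ /setP/(_ u).
  by rewrite !inE eqxx orbT eq_sym (negPf vu) => /esym/eqP.
apply: eq_card => e; rewrite inE; apply/imsetP/andP => [[u]|[eG ve]].
  by rewrite inE => vu ->; rewrite set21.
have /eqP/cards2P[x [y [_ eE]]] := card_edge eG.
move: ve eG; rewrite eE !inE => /orP[] /eqP-> eG.
  by exists y; rewrite ?inE.
by exists x; rewrite ?inE /adjacent setUC.
Qed.

Lemma sum_degree : \sum_v degree G v = #|edges G|.*2.
Proof.
(* Double counting of incident vertex-edge pairs: each edge is counted once at each of its two
   ends. *)
under eq_bigr do rewrite degree_incident -sum1dep_card big_mkcondr.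
rewrite exchange_big -mul2n mulnC -sum_nat_const; apply: eq_bigr => e eG.
by rewrite -big_mkcond sum1_card card_edge.
Qed.

Lemma degree_leq_max (v : V) : degree G v <= max_degree G.
Proof. exact: (leq_bigmax v). Qed.

Lemma max_degree_witness : 0 < #|V| -> exists v, degree G v = max_degree G.
Proof. by move=> V0; have [v vE] := eq_bigmax (degree G) V0; exists v. Qed.

(* [v] is not adjacent to itself, so this says that at most one other vertex is
   missing from its neighbourhood. *)
Lemma degree_geP (v : V) :
  reflect (forall u w, u != v -> w != v -> u != w ->
             adjacent G v u || adjacent G v w)
          (#|V| - 2 <= degree G v).
Proof.
have deg_compl := cardsC [set u | adjacent G v u].
(* [N] consists of [v] and its non-neighbours, so removing [v] leaves the vertices it misses. *)
set N := ~: _ in deg_compl.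
have vN : v \in N by rewrite !inE; apply/negP => /adjacent_neq; rewrite eqxx.
have N_v := cardsD1 v N; rewrite vN in N_v.
have ->: (#|V| - 2 <= degree G v) = (#|N :\ v| <= 1) by rewrite /degree; lia.
apply: (iffP (card_le1_eqP)) => [N1 u w uv wv|adj u w].
  apply: contraNT; rewrite negb_or => /andP[vu vw].
  by apply/eqP/N1; rewrite !inE ?uv ?wv.
rewrite !inE => /andP[uv vu] /andP[wv vw]; apply/eqP/negPn/negP => uw.
by have := adj _ _ wv uv uw; rewrite (negPf vu) (negPf vw).
Qed.

(** The witness is the star with centre [a] and leaves [b], [c]; any two of its vertices are
    connected through [a]. *)
Lemma steiner_dist_le2 (a b c : V) :
  adjacent G a b -> adjacent G a c ->
  ele (steiner_dist G [set a; b; c]) (efin 2).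
Proof.
move=> ab ac; apply/ele_emin_over.
pose E := [set [set a; b]; [set a; c]].
exists ([set a; b; c], E) => /=; last by rewrite cards2; case: (_ != _).
rewrite subxx andbT; apply/and3P; split=> /=.
- apply/andP; split=> /=.
    by apply/subsetP => e; rewrite !inE => /orP[] /eqP->.
  apply/forall_inP => e; rewrite !inE => /orP[] /eqP->; apply/subsetP => x;
    by rewrite !inE => /orP[] ->; rewrite ?orbT.
- by apply/set0Pn; exists a; rewrite !inE eqxx.
set e := [rel u v | _].
have e_sym : connect_sym e.
  by apply: sym_connect_sym => u v; rewrite /e /= setUC.
have conn_a x : x \in [set a; b; c] -> connect e a x.
  rewrite !inE -orbA => /or3P[] /eqP->; first exact: connect0.
    by apply: connect1; rewrite /e /= !inE eqxx.
  by apply: connect1; rewrite /e /= !inE eqxx orbT.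
apply/forall_inP => x xS; apply/forall_inP => y yS.
by apply: connect_trans (conn_a y yS); rewrite e_sym conn_a.
Qed.

(** Each of the three vertices lies on an edge of the connecting subgraph. If [v] misses both [u]
    and [w], its edge avoids them, so the only other available edge must join [u] to [w], which cuts
    [v] off. *)
Lemma steiner_dist_le2_adjacent (v u w : V) :
  u != v -> w != v -> u != w ->
  ele (steiner_dist G [set v; u; w]) (efin 2) ->
  adjacent G v u || adjacent G v w.
Proof.
move=> uv wv uw /ele_emin_over[[X E] /= /andP[/and3P[/andP[/= EG _] _ conn] SX] E2].
set e := [rel x y | _] in conn.
have connS x y : x \in [set v; u; w] -> y \in [set v; u; w] -> connect e x y.
  move=> /(subsetP SX) xX /(subsetP SX) yX.
  by have /forall_inP/(_ _ xX)/forall_inP/(_ _ yX) := conn.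
have [vS uS wS] : [/\ v \in [set v; u; w], u \in [set v; u; w]
                    & w \in [set v; u; w]] by rewrite !inE !eqxx !orbT.
(* A walk between distinct vertices is nonempty, so its first step is an edge at [x]. *)
have step x y : x \in [set v; u; w] -> y \in [set v; u; w] -> x != y ->
    exists z, [set x; z] \in E.
  move=> xS yS; have /connectP[[|z p] /= zp ->] := connS x y xS yS.
    by rewrite eqxx.
  by case/andP: zp => xz _ _; exists z.
apply: contraT; rewrite negb_or => /andP[nvu nvw].
have [x vx] : exists z, [set v; z] \in E by apply: (step v u); rewrite 1?eq_sym.
have [y uy] := step u v uS vS uv.
have [z wz] := step w v wS vS wv.
have xu : x != u by apply: contraNneq nvu => <-; apply: subsetP EG _ vx.
have xw : x != w by apply: contraNneq nvw => <-; apply: subsetP EG _ vx.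
have vx_uy : [set v; x] != [set u; y].
  by apply/eqP => /setP/(_ u); rewrite !inE eqxx (negPf uv) eq_sym (negPf xu).
have vx_wz : [set v; x] != [set w; z].
  by apply/eqP => /setP/(_ w); rewrite !inE eqxx (negPf wv) eq_sym (negPf xw).
have EE : E = [set [set v; x]; [set u; y]].
  apply/esym/eqP; rewrite eqEcard subUset !sub1set vx uy /=.
  by rewrite cards2 vx_uy.
have uyE : [set u; y] = [set w; z].
  by move: wz; rewrite EE !inE eq_sym (negPf vx_wz) /= => /eqP.
have yw : y = w.
  by have /setP/(_ w) := uyE; rewrite !inE eqxx eq_sym (negPf uw) => /eqP.
(* Now [E] consists of the disjoint edges [vx] and [uw], so [v] cannot be
   reached from [u]. *)
have clos : closed e [set u; w].
  apply: intro_closed => [|a b]; first by apply: sym_connect_sym => a b; rewrite /e /= setUC.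
  rewrite /e /= EE yw => /set2P[] /setP abE aS.
    have := abE a; rewrite !inE eqxx /= => /esym/orP[] /eqP aE; move: aS;
      rewrite aE !inE.
      by rewrite ![v == _]eq_sym (negPf uv) (negPf wv).
    by rewrite (negPf xu) (negPf xw).
  by rewrite -abE !inE eqxx orbT.
have := closed_connect clos (connS u v uS vS).
by rewrite !inE eqxx ![v == _]eq_sym (negPf uv) (negPf wv).
Qed.

(** When every vertex misses at most one other, the missing pairs are disjoint, so a triple contains
    at most one of them and its other two pairs form a star. *)
Lemma sdiam3_le2P :
  reflect (forall v, #|V| - 2 <= degree G v) (ele (sdiam3 G) (efin 2)).
Proof.
apply: (iffP (ele_big_emax _ _ _)) => [dist2 v|deg S /eqP S3].
  apply/degree_geP => u w uv wv uw.
  apply: steiner_dist_le2_adjacent => //; apply: dist2.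
  by rewrite setUC cardsU1 !inE negb_or wv (eq_sym w) uw cards2 (eq_sym v) uv.
have [a aS] : exists a, a \in S by apply/set0Pn; rewrite -card_gt0 S3.
have /eqP/cards2P[b [c [bc SE]]] : #|S :\ a| = 2.
  by have := cardsD1 a S; rewrite aS S3 => -[].
have /setD1P[ba _] : b \in S :\ a by rewrite SE set21.
have /setD1P[ca _] : c \in S :\ a by rewrite SE set22.
have {}SE : S = [set a; b; c] by rewrite -(setD1K aS) SE setUA.
have [ab ac cb] : [/\ a != b, a != c & c != b] by split; rewrite eq_sym.
have adj v u w := elimT (degree_geP v) (deg v) u w.
have := adj a b c ba ca bc; have := adj b a c ab cb ac; have := adj c a b ac bc ab.
rewrite !(adjacent_sym c) (adjacent_sym b a).
(* The centre of the star is the vertex outside the missing pair, or [a] if no pair is missing. *)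
have [Gab|_] := boolP (adjacent G a b).
  have [Gac|_ /= Gbc _ _] := boolP (adjacent G a c).
    by rewrite SE steiner_dist_le2.
  by rewrite SE [[set a; b]]setUC steiner_dist_le2 // adjacent_sym.
move=> _ /= Gbc Gac.
by rewrite SE setUC setUA steiner_dist_le2 // adjacent_sym.
Qed.

End Graph.

Lemma mem_H3_2 (n l : nat) (G : sgraph 'I_n) :
  reflect (max_degree G = l /\ forall v, n - 2 <= degree G v) (G \in H3 n l 2).
Proof.
rewrite inE; apply: (iffP andP) => -[].
  by move=> /eqP-> /sdiam3_le2P; rewrite card_ord.
by move=> -> deg; rewrite eqxx; split=> //; apply/sdiam3_le2P; rewrite card_ord.
Qed.

(** * Complements of matchings *)

Section MatchingComplement.
Variables (V : finType) (p : V -> V).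
Hypothesis pK : involutive p.

(** The matching consists of the pairs of [x] and [p x] with [p x != x]; fixed points of [p] are the
    unmatched vertices. *)
Definition matching_complement_edges : {set {set V}} :=
  [set [set q.1; q.2] | q : V * V & (q.1 != q.2) && (q.2 != p q.1)].

Lemma matching_complement_card2 :
  [forall e in matching_complement_edges, #|e| == 2].
Proof.
by apply/forall_inP => e /imsetP[[x y]]; rewrite inE => /andP[/= xy _] ->; rewrite cards2 xy.
Qed.

Definition matching_complement : sgraph V := SGraph matching_complement_card2.

Lemma adjacent_matching_complement (x y : V) :
  adjacent matching_complement x y = (y \notin [set x; p x]).
Proof.
rewrite !inE negb_or eq_sym; apply/imsetP/idP => [[[a b]]|xy]; last first.
  by exists (x, y); rewrite ?inE.
rewrite inE /= => /andP[ab bpa] /setP xyE.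
have := xyE x; have := xyE y; have := xyE a; have := xyE b.
rewrite !inE !eqxx ?orbT /= => /orP[] /eqP bE /orP[] /eqP aE; subst.
- by rewrite eqxx in ab.
(* Here the pair is listed in reverse order, and involutivity carries the condition on [p] from one
   end to the other. *)
- move=> _ _; rewrite eq_sym ab /=.
  by apply: contraNneq bpa => ->; rewrite pK.
- by rewrite ab bpa.
- by rewrite eqxx in ab.
Qed.

Lemma degree_matching_complement (x : V) :
  degree matching_complement x = #|V| - (x != p x).+1.
Proof.
rewrite -(cardsC [set x; p x]) cards2 addKn; apply: eq_card => y.
by rewrite inE adjacent_matching_complement [RHS]inE.
Qed.

End MatchingComplement.

(* Exchanges [2 i] and [2 i + 1] for [i < k]. *)
Definition swap_pairs (k i : nat) : nat :=
  if i < k.*2 then (if odd i then i.-1 else i.+1) else i.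

Lemma swap_pairs_ltn (n k i : nat) : k.*2 <= n -> i < n -> swap_pairs k i < n.
Proof. by rewrite /swap_pairs; do 2?case: ifP; lia. Qed.

Lemma swap_pairsK (k : nat) : involutive (swap_pairs k).
Proof.
move=> i; rewrite {2}/swap_pairs; case: ifP => ik; last by rewrite /swap_pairs ik.
by case: ifP => io; rewrite /swap_pairs; do 2?case: ifP; lia.
Qed.

Lemma swap_pairs_neq (k i : nat) : (i != swap_pairs k i) = (i < k.*2).
Proof. by rewrite /swap_pairs; do 2?case: ifP; lia. Qed.

Lemma exists_matching_complement (n k : nat) : k.*2 <= n ->
  exists G : sgraph 'I_n, forall v : 'I_n, degree G v = n - (v < k.*2).+1.
Proof.
move=> kn; pose p (i : 'I_n) := Ordinal (swap_pairs_ltn kn (ltn_ord i)).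
have pK : involutive p by move=> i; apply/val_inj/swap_pairsK.
exists (matching_complement p) => v; rewrite (degree_matching_complement pK) card_ord.
by rewrite -(swap_pairs_neq k v).
Qed.

Lemma sum_ltn_ord (n m : nat) : m <= n -> \sum_(v < n) (v < m) = m.
Proof.
move=> mn; rewrite -big_mkcond -(big_ord_widen n (fun=> 1) mn).
by rewrite sum1_card card_ord.
Qed.

(** * Extremal edge counts *)

Lemma double_bin2 (n : nat) : 'C(n, 2).*2 = n * n.-1.
Proof.
by rewrite bin2 halfK; case: n => //= n; rewrite oddM /=; case: odd; rewrite ?subn0.
Qed.

(** Reduces every finite value to its lower bound. The complement of a matching with [k] edges has
    maximum degree [n - 1], or [n - 2] when the matching is perfect, which is the case
    [k.*2 == n]. *)
Lemma e3_matching_complement (n l k : nat) :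
  k.*2 <= n -> l = n - (k.*2 == n).+1 -> 0 < n ->
  (forall G, G \in H3 n l 2 -> 'C(n, 2) - k <= #|edges G|) ->
  e3 n l 2 = efin ('C(n, 2) - k).
Proof.
move=> kn lE n0 lower.
have [G degG] := exists_matching_complement kn.
have sumG : #|edges G|.*2 + k.*2 = n * n.-1.
  rewrite -sum_degree -(sum_ltn_ord kn) -big_split /=.
  rewrite -[X in X * _]card_ord -sum_nat_const; apply: eq_bigr => v _.
  by rewrite degG; have := ltn_ord v; lia.
have edgesG : #|edges G| = 'C(n, 2) - k by have := double_bin2 n; lia.
rewrite -edgesG; apply: emin_over_efin => [|G' /lower]; last by rewrite edgesG.
apply/mem_H3_2; split=> [|v]; last by rewrite degG; case: (v < _); lia.
apply/eqP; rewrite eqn_leq; apply/andP; split.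
  by apply/bigmax_leqP => v _; rewrite degG lE; have := ltn_ord v; lia.
(* The last vertex is matched only by a perfect matching, so it attains the maximum degree. *)
have lastP : n.-1 < n by lia.
by apply: leq_trans (degree_leq_max _ (Ordinal lastP)); rewrite degG lE /=; lia.
Qed.

(** One vertex has degree [l], and the [n.-1] others have degree at least [n - 2]. *)
Lemma leq_edges_H3_2 (n l : nat) (G : sgraph 'I_n) :
  0 < n -> G \in H3 n l 2 -> n.-1 * (n - 2) + l <= #|edges G|.*2.
Proof.
move=> n0 /mem_H3_2[<- deg]; rewrite -sum_degree.
have [|v <-] := max_degree_witness G; first by rewrite card_ord.
rewrite (bigD1 v) //= addnC leq_add2l.
have -> : n.-1 = #|predC1 v| by rewrite cardC1 card_ord.
by rewrite -sum_nat_const; apply: leq_sum.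
Qed.

Theorem theorem3p1 (n : nat) (hn : 3 <= n) :
  (forall l : nat, l = n - 1 ->
     (odd n -> e3 n l 2 = efin ('C(n, 2) - (n - 1) %/ 2)) /\
     (~~ odd n -> e3 n l 2 = efin ('C(n, 2) - (n - 2) %/ 2))) /\
  (forall l : nat, l = n - 2 ->
     (~~ odd n -> e3 n l 2 = efin ('C(n, 2) - n %/ 2)) /\
     (odd n -> e3 n l 2 = einfty)).
Proof.
have n0 : 0 < n by lia.
have binE := double_bin2 n.
split=> l lE; split=> odd_n.
- apply: e3_matching_complement => // [||G /leq_edges_H3_2 -/(_ n0)]; [lia|lia|].
  by rewrite lE; nia.
- apply: e3_matching_complement => // [||G /leq_edges_H3_2 -/(_ n0)]; [lia|lia|].
  (* The degree sum is at least the square of [n - 1], which is odd for even [n]; being even, the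
     sum exceeds it by at least one. *)
  have [m nE] : exists m, n = m.*2 by exists n./2; lia.
  by rewrite lE; subst n; nia.
- apply: e3_matching_complement => // [||G /leq_edges_H3_2 -/(_ n0)]; [lia|lia|].
  by rewrite lE; nia.
(* Such a graph would be regular of degree [n - 2], with the odd degree sum [n * (n - 2)]. *)
apply: emin_over_einfty => G; apply/mem_H3_2 => -[max deg].
have := sum_degree G; rewrite (eq_bigr (fun=> n - 2)) => [|v _]; last first.
  by apply/eqP; rewrite eqn_leq deg andbT -lE -max degree_leq_max.
rewrite sum_nat_const card_ord => /(congr1 odd).
by rewrite odd_double oddM odd_n; lia.
Qed.
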